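(* Let $f:\Sigma\to\mathbb{R}^3$ be a coplanar $k$-unduloid with pole solutions $P_1,\dots,P_k$ on $\overline{\Sigma^+}$. Then $P_1,\dots,P_k$ are the vertices of the classifying polygonal disc of $f(\Sigma)$: with $\alpha_1,\dots,\alpha_k\in S^2$ the vertices of the classifying polygon, for every $q\in\overline{\Sigma^+}$ there is a rotation $R\in SO(3)$ such that $P_j(q)=R\,\alpha_j$ for all $j=1,\dots,k$.
   Context: CMC surfaces. For an immersion $f:\Sigma\to\mathbb{R}^3$ of a surface, $\Delta_f f=2H_f\nu$, where $\nu$ is the (inner) unit normal, $\Delta_f$ the Laplace-Beltrami operator and $H_f$ the mean curvature. A CMC surface is one with $H_f\equiv1$; all CMC surfaces are assumed complete, of finite topology, and Alexandrov-immersed: $f$ is proper, $\Sigma=\partial M$ for a 3-manifold $M$ into which $\nu$ points, and $f$ extends to a proper immersion of $M$ into $\mathbb{R}^3$. Each end of such a surface is exponentially asymptotic to a Delaunay unduloid (embedded rotationally symmetric periodic CMC surface, including the cylinder), whose axis is the asymptotic axis of the end. Coplanar $k$-unduloids. A coplanar $k$-unduloid is a CMC surface of genus zero with $k$ ends whose asymptotic axes all lie in a plane, normalized to be the $xy$-plane; $e_3$ is the unit vertical vector. It is known that it is Alexandrov symmetric: it is invariant under reflection in $\{z=0\}$, and its halves $\Sigma^{\pm}=\{\pm z>0\}$ are graphs over a (possibly immersed) planar domain. The half $\Sigma^+$ is a topological disc, whose boundary is a union of $k$ curves $\gamma_1,\dots,\gamma_k$ ($\gamma_j$ joins end $E_{j-1}$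 to end $E_j$ in the natural cyclic order of the ends), lying in $\{z=0\}$ and oriented so that $df(J\gamma_j')=-e_3$ in unit-speed parameterization, where $J$ is the complex structure of $\Sigma$ (rotation by $90^\circ$ in the induced metric, with $(X,JX,\nu)$ positively oriented). Pole solutions. $P_j:\overline{\Sigma^+}\to\mathbb{R}^3$ is the solution of $d\epsilon=2\,\epsilon\times(df\circ J)$ with value $P_j=e_3$ at some (hence every) point of $\gamma_j$; this system is integrable on $\overline{\Sigma^+}$. Classifying polygon. Identify $\mathbb{R}^3$ with the imaginary quaternions and $S^3$ with the unit quaternions. The conjugate cousin $\tilde f:\overline{\Sigma^+}\to S^3$ is a solution of $d\tilde f=\tilde f\,(df\circ J)$ (quaternion product); it is unique up to left multiplication by a constant unit quaternion. Along each $\gamma_j$ the point $\tilde f\,e_3\,\tilde f^{-1}\in S^2$ (Hopf projection) is constant; call it $\alpha_j$. The vertices of the classifying polygon are $\alpha_1,\dots,\alpha_k$ (well defined up to a common rotation). *)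

(* Defs.v *)
(* MathComp + MathComp-Analysis.  Vectors are rows: a linear map given by a
   matrix D sends v to v *m D. *)
From HB Require Import structures.
From mathcomp Require Import all_boot all_order all_algebra.
From mathcomp Require Import all_classical all_reals all_analysis.

Set Implicit Arguments.
Unset Strict Implicit.
Unset Printing Implicit Defensive.

Import Order.TTheory GRing.Theory Num.Theory.
Import numFieldNormedType.Exports.

Local Open Scope classical_set_scope.
Local Open Scope ring_scope.

Section Algebra.
Context {R : realType}.

Definition dot n (u v : 'rV[R]_n) : R := (u *m v^T) 0 0.

(* The norm `|v| of the library on 'rV_n is the sup norm. *)
Definition enorm n (u : 'rV[R]_n) : R := Num.sqrt (dot u u).

Definition cross (u v : 'rV[R]_3) : 'rV[R]_3 :=
  \row_k [:: u 0 1 * v 0 2 - u 0 2 * v 0 1;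
             u 0 2 * v 0 0 - u 0 0 * v 0 2;
             u 0 0 * v 0 1 - u 0 1 * v 0 0]`_k.

Definition e3 : 'rV[R]_3 := delta_mx 0 2.
Definition height (v : 'rV[R]_3) : R := v 0 2.
Definition reflect_z (v : 'rV[R]_3) : 'rV[R]_3 := v - (2 * height v) *: e3.

Definition SO3 (A : 'M[R]_3) : Prop := A *m A^T = 1%:M /\ \det A = 1.

End Algebra.

(* Quaternions as pairs (real part, imaginary part), so that the normed module
   structure on products applies. *)
Notation quaternion R := (R * 'rV[R]_3)%type.

Section Quaternions.
Context {R : realType}.
Implicit Types p q : quaternion R.

Definition qmul p q : quaternion R :=
  (p.1 * q.1 - dot p.2 q.2, p.1 *: q.2 + q.1 *: p.2 + cross p.2 q.2).

Definition qim (v : 'rV[R]_3) : quaternion R := (0, v).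

Definition qnorm2 q : R := q.1 ^+ 2 + dot q.2 q.2.

Definition qinv q : quaternion R := (q.1 / qnorm2 q, - (qnorm2 q)^-1 *: q.2).

Definition unit_quaternion q : Prop := qnorm2 q = 1.

Definition hopf q : quaternion R := qmul (qmul q (qim e3)) (qinv q).

End Quaternions.

Section Calculus.
Context {R : realType}.

(* h is differentiable at x relatively to the set A, with differential L. *)
Definition diff_within (V W : normedModType R) (A : set V) (h : V -> W) (x : V)
    (L : V -> W) : Prop :=
  forall e : R, 0 < e ->
    \forall y \near within A (nbhs x), `|h y - h x - L (y - x)| <= e * `|y - x|.

Fixpoint Cn (V W : normedModType R) (n : nat) (O : set V) (h : V -> W) : Prop :=
  match n with
  | 0 => forall x, O x -> {for x, continuous h}
  | m.+1 => (forall x, O x -> differentiable h x) /\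
            forall v, Cn m O (fun x => 'D_v h x)
  end.

(* Smoothness on an arbitrary subset A: local existence of smooth extensions. *)
Definition smooth_on (V W : normedModType R) (A : set V) (h : V -> W) : Prop :=
  forall x, A x -> exists O g,
    [/\ open O, O x, forall n, Cn n O g & forall y, A y -> O y -> h y = g y].

End Calculus.

Definition homeo_on (X Y : topologicalType) (A : set X) (B : set Y)
    (f : X -> Y) (g : Y -> X) : Prop :=
  [/\ forall x, A x -> B (f x) /\ g (f x) = x,
      forall y, B y -> A (g y) /\ f (g y) = y,
      {within A, continuous f} & {within B, continuous g}].

Section Manifolds.
Context {R : realType}.

(* Only the values of cmap on cdom, and of cinv on the image of cdom, matter. *)
Record chart (T : Type) (n : nat) := Chart {
  cdom : set T;
  cmap : T -> 'rV[R]_n;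
  cinv : 'rV[R]_n -> T }.

Definition cimg (T : Type) n (c : chart T n) : set 'rV[R]_n :=
  cmap c @` cdom c.

(* A smooth atlas modelled on H: H = setT for manifolds without boundary and
   H = a closed half space for manifolds with boundary. *)
Definition smooth_atlas (T : topologicalType) n (H : set 'rV[R]_n)
    (A : set (chart T n)) : Prop :=
  [/\ forall c, A c -> open (cdom c) /\
        exists2 O, open O & homeo_on (cdom c) (O `&` H) (cmap c) (cinv c),
      forall q : T, exists2 c, A c & cdom c q
    & forall c d, A c -> A d ->
        smooth_on (cmap c @` (cdom c `&` cdom d)) (cmap d \o cinv c)].

Record manifold (n : nat) (H : set 'rV[R]_n) := Manifold {
  carrier :> topologicalType;
  atlas : set (chart carrier n);
  manifold_hausdorff : hausdorff_space carrier;
  manifold_countable : @second_countable carrier;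
  manifold_atlas : smooth_atlas H atlas }.

Definition half_space n : set 'rV[R]_n.+1 := [set x | 0 <= x 0 ord_max].

Definition boundary n (M : manifold (@half_space n)) : set M :=
  [set m | exists2 c, atlas c & cdom c m /\ cmap c m 0 ord_max = 0].

(* The expression of u in the chart c. *)
Definition in_chart (T W : Type) n (u : T -> W) (c : chart T n) : 'rV[R]_n -> W :=
  u \o cinv c.

Definition smooth_fun n (H : set 'rV[R]_n) (M : manifold H)
    (W : normedModType R) (u : M -> W) : Prop :=
  forall c, atlas c -> smooth_on (cimg c) (in_chart u c).

Definition smooth_map n (H : set 'rV[R]_n) (M : manifold H)
    m (H' : set 'rV[R]_m) (N : manifold H') (u : M -> N) : Prop :=
  continuous u /\
  forall (c : chart M n) (d : chart N m), atlas c -> atlas d ->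
    smooth_on (cmap c @` (cdom c `&` u @^-1` cdom d)) (cmap d \o u \o cinv c).

Definition smooth_curve n (H : set 'rV[R]_n) (M : manifold H)
    (c : R -> M) : Prop :=
  continuous c /\
  forall d : chart M n, atlas d ->
    smooth_on (c @^-1` cdom d : set R^o) (cmap d \o c).

Definition immersion n (H : set 'rV[R]_n) (M : manifold H) m
    (u : M -> 'rV[R]_m) : Prop :=
  smooth_fun u /\
  forall c x (D : 'M[R]_(n, m)), atlas c -> cimg c x ->
    diff_within (cimg c) (in_chart u c) x (mulmx^~ D) -> row_free D.

(* omega c x is the expression in the chart c, at the point of coordinates x,
   of a vector-valued 1-form; du = omega holds on A, derivatives being taken
   relatively to A. *)
Definition differential_eq n (H : set 'rV[R]_n) (M : manifold H)
    (W : normedModType R) (A : set M) (u : M -> W)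
    (omega : chart M n -> 'rV[R]_n -> 'rV[R]_n -> W) : Prop :=
  forall c q, atlas c -> cdom c q -> A q ->
    diff_within (cmap c @` (cdom c `&` A)) (in_chart u c) (cmap c q)
      (omega c (cmap c q)).

End Manifolds.

Notation surface R := (@manifold R 2 setT).

Section ParametrizedSurfaces.
Context {R : realType}.

Definition induced_metric (h : 'rV[R]_2 -> 'rV[R]_3) (x : 'rV[R]_2) : 'M[R]_2 :=
  jacobian h x *m (jacobian h x)^T.

(* (det g)^(-1/2) sum_ij d_i ((det g)^(1/2) g^ij d_j u) *)
Definition laplace_beltrami (g : 'rV[R]_2 -> 'M[R]_2) (W : normedModType R)
    (u : 'rV[R]_2 -> W) (x : 'rV[R]_2) : W :=
  let vol y := Num.sqrt (\det (g y)) in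
  (vol x)^-1 *: \sum_(i < 2) 'D_(delta_mx 0 i)
    (fun y => \sum_(j < 2) (vol y * invmx (g y) i j) *: 'D_(delta_mx 0 j) u y) x.

Definition unit_normal_at (h : 'rV[R]_2 -> 'rV[R]_3) (x : 'rV[R]_2)
    (nu : 'rV[R]_3) : Prop :=
  dot nu nu = 1 /\ forall v, dot (v *m jacobian h x) nu = 0.

Definition mean_curvature_at (h : 'rV[R]_2 -> 'rV[R]_3) (x : 'rV[R]_2)
    (nu : 'rV[R]_3) (H : R) : Prop :=
  laplace_beltrami (induced_metric h) h x = (2 * H) *: nu.

(* Surface of revolution with profile r about the line b + R (row 0 F), where F
   is an orthogonal matrix; the coordinates are the abscissa s along the axis
   and the angle theta. *)
Definition radial (F : 'M[R]_3) (x : 'rV[R]_2) : 'rV[R]_3 :=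
  cos (x 0 1) *: row 1 F + sin (x 0 1) *: row 2 F.

Definition revolution (b : 'rV[R]_3) (F : 'M[R]_3) (r : R -> R)
    (x : 'rV[R]_2) : 'rV[R]_3 :=
  b + x 0 0 *: row 0 F + r (x 0 0) *: radial F x.

(* The embedded Delaunay surfaces are the periodic ones whose profile is a
   positive function of the abscissa; constant r is the cylinder. *)
Definition delaunay_unduloid (b : 'rV[R]_3) (F : 'M[R]_3) (r : R -> R) : Prop :=
  [/\ F *m F^T = 1%:M,
      forall n, Cn n setT (r : R^o -> R^o),
      forall s, 0 < r s,
      exists2 T, 0 < T & forall s, r (s + T) = r s
    & forall x, exists nu, [/\ unit_normal_at (revolution b F r) x nu,
        dot nu (radial F x) < 0 & mean_curvature_at (revolution b F r) x nu 1]].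

End ParametrizedSurfaces.

Section CMCSurfaces.
Context {R : realType} (S : surface R).
Implicit Types (f nu : S -> 'rV[R]_3).

Definition jac f (c : chart S 2) (x : 'rV[R]_2) : 'M[R]_(2, 3) :=
  jacobian (in_chart f c) x.

Definition unit_normal f nu : Prop :=
  forall c q, atlas c -> cdom c q -> unit_normal_at (in_chart f c) (cmap c q) (nu q).

Definition mean_curvature f nu (H : S -> R) : Prop :=
  forall c q, atlas c -> cdom c q ->
    mean_curvature_at (in_chart f c) (cmap c q) (nu q) (H q).

Definition proper_map (X Y : topologicalType) (u : X -> Y) : Prop :=
  continuous u /\ forall K, compact K -> compact (u @^-1` K).

(* The smooth homeomorphism i from S onto the boundary of M is automatically a
   diffeomorphism, since F \o i is an immersion.  A vector at a boundary point
   points into M when its last coordinate in half-space charts is positive. *)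
Definition alexandrov_immersed f nu : Prop :=
  proper_map f /\
  exists (M : manifold (@half_space R 2)) (i : S -> M) (j : M -> S)
      (F : M -> 'rV[R]_3),
    [/\ smooth_map i /\ homeo_on setT (boundary (M := M)) i j,
        proper_map F, immersion F, F \o i = f
      & forall (c : chart M 3) q (D : 'M[R]_3), atlas c -> cdom c (i q) ->
          diff_within (cimg c) (in_chart F c) (cmap c (i q)) (mulmx^~ D) ->
          exists2 w : 'rV[R]_3, 0 < w 0 ord_max & nu q = w *m D].

Definition image_length f (c : R -> S) : \bar R :=
  (\int[@lebesgue_measure R]_(t in `[0%R, 1%R]) (enorm (derive1 (f \o c) t))%:E)%E.

Definition joined_below f (a b : S) (e : R) : Prop :=
  exists c : R -> S, [/\ smooth_curve c, c 0 = a, c 1 = b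
    & (image_length f c < e%:E)%E].

(* Every Cauchy sequence for the distance of the induced metric converges. *)
Definition complete_surface f : Prop :=
  forall u : nat -> S,
    (forall e : R, 0 < e -> exists N : nat, forall m n : nat,
       (N <= m)%N -> (N <= n)%N -> joined_below f (u m) (u n) e) ->
    exists q : S, u @ \oo --> q.

(* Finite topology and genus zero with k ends: S is homeomorphic, through h, to
   the unit sphere punctured at k points p_j; the end E_j consists of the
   neighbourhoods of p_j. *)
Definition genus_zero_ends k (h : S -> 'rV[R]_3) (p : 'I_k -> 'rV[R]_3) : Prop :=
  [/\ injective p, forall j, enorm (p j) = 1
    & exists g, homeo_on setT ([set x | enorm x = 1] `\` range p) h g].

Definition cmc_surface k f nu (h : S -> 'rV[R]_3) (p : 'I_k -> 'rV[R]_3) : Prop :=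
  [/\ immersion f /\ unit_normal f nu, alexandrov_immersed f nu,
      complete_surface f, genus_zero_ends h p & mean_curvature f nu (fun=> 1)].

(* Some neighbourhood of the end is parametrized, through psi, by a half
   cylinder with coordinates s >= 0 and theta modulo 2 pi, so that it is
   exponentially close to a Delaunay unduloid with axis b + R (row 0 F). *)
Definition asymptotic_unduloid f (h : S -> 'rV[R]_3) (pj : 'rV[R]_3)
    (b : 'rV[R]_3) (F : 'M[R]_3) : Prop :=
  let half := [set x : 'rV[R]_2 | 0 <= x 0 0] in
  exists (r : R -> R) (psi : 'rV[R]_2 -> S) (C lambda : R),
    delaunay_unduloid b F r /\
    [/\ {within half, continuous psi},
        forall x y, half x -> half y -> psi x = psi y <->
          x 0 0 = y 0 0 /\ exists m : int, y 0 1 = x 0 1 + (2 * pi) *~ m,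
        exists2 O, nbhs pj O & (h @^-1` O `<=` psi @` half),
        forall O, nbhs pj O -> exists s0 : R, forall x, half x ->
          s0 <= x 0 0 -> O (h (psi x))
      & 0 < lambda /\ forall x, half x ->
          enorm (f (psi x) - revolution b F r x) <= C * expR (- lambda * x 0 0)].

Definition coplanar_unduloid k f nu (h : S -> 'rV[R]_3)
    (p : 'I_k -> 'rV[R]_3) : Prop :=
  cmc_surface f nu h p /\
  forall j, exists b F, [/\ asymptotic_unduloid f h (p j) b F,
    height b = 0 & height (row 0 F) = 0].

Definition upper f : set S := [set q | 0 < height (f q)].
Definition lower f : set S := [set q | height (f q) < 0].

(* The two halves are graphs over an immersed planar domain when their vertical
   projection to the plane is an immersion. *)
Definition alexandrov_symmetric f : Prop :=
  (exists sigma : S -> S, [/\ smooth_map sigma, sigma \o sigma = id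
     & f \o sigma = reflect_z \o f]) /\
  forall c q, atlas c -> cdom c q -> (upper f `|` lower f) q ->
    row_free (col' 2 (jac f c (cmap c q))).

(* J c x is the matrix of J in the chart c, at the point of coordinates x. *)
Definition complex_structure f nu (J : chart S 2 -> 'rV[R]_2 -> 'M[R]_2) : Prop :=
  forall c q v, atlas c -> cdom c q ->
    let D := jac f c (cmap c q) in
    let X := v *m D in
    let JX := v *m J c (cmap c q) *m D in
    [/\ dot JX JX = dot X X, dot X JX = 0
      & v != 0 -> 0 < dot (cross X JX) (nu q)].

Definition dfJ f (J : chart S 2 -> 'rV[R]_2 -> 'M[R]_2) (c : chart S 2)
    (x v : 'rV[R]_2) : 'rV[R]_3 := v *m J c x *m jac f c x.

Definition upper_half_disc f : Prop :=
  exists a b, homeo_on (upper f) [set x : 'rV[R]_2 | enorm x < 1] a b.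

(* gamma_j runs from the end E_(j-1) to the end E_j, indices being cyclic. *)
Definition boundary_curves k f (J : chart S 2 -> 'rV[R]_2 -> 'M[R]_2)
    (h : S -> 'rV[R]_3) (p : 'I_k -> 'rV[R]_3) (gamma : 'I_k -> R -> S) : Prop :=
  closure (upper f) `\` upper f = \bigcup_j range (gamma j) /\
  forall j,
    [/\ smooth_curve (gamma j),
        forall t, height (f (gamma j t)) = 0,
        forall t, enorm (derive1 (f \o gamma j) t) = 1,
        h (gamma j t) @[t --> -oo] --> p (ord_pred j) /\
        h (gamma j t) @[t --> +oo] --> p j
      & forall c t, atlas c -> cdom c (gamma j t) ->
          dfJ f J c (cmap c (gamma j t)) (derive1 (cmap c \o gamma j) t) = - e3].

Definition pole_solution f (J : chart S 2 -> 'rV[R]_2 -> 'M[R]_2)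
    (gammaj : R -> S) (P : S -> 'rV[R]_3) : Prop :=
  differential_eq (closure (upper f)) P
    (fun c x v => 2 *: cross (in_chart P c x) (dfJ f J c x v)) /\
  exists t, P (gammaj t) = e3.

Definition conjugate_cousin f (J : chart S 2 -> 'rV[R]_2 -> 'M[R]_2)
    (ft : S -> quaternion R) : Prop :=
  (forall q, closure (upper f) q -> unit_quaternion (ft q)) /\
  differential_eq (closure (upper f)) ft
    (fun c x v => qmul (in_chart ft c x) (qim (dfJ f J c x v))).

(* hopf \o ft is constant along gamma_j by the equation for ft, so its value at
   one point determines the vertex. *)
Definition classifying_vertex (ft : S -> quaternion R) (gammaj : R -> S)
    (a : 'rV[R]_3) : Prop :=
  exists t, hopf (ft (gammaj t)) = qim a.

End CMCSurfaces.

(* Main.v *)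
(* The rotations v |-> q v q^* induced by the cousin q = ft turn the pole
   equation into a trivial one: with w = df o J, the derivative of q P q^* is
   q (w P - P w + 2 P x w) q^* = 0 because w P - P w = 2 w x P.  So q P_j q^* is
   constant on the closed upper half; along gamma_j, where w = - e3, the same
   computation applied to the constant e3 shows that q e3 q^* is constant, and
   the two constants agree where P_j = e3.  Hence P_j = q^* alpha_j q.

   Constancy of q P_j q^* is only derived on the open half, along segments in
   charts, and extended to its closure by continuity; no regularity of the
   boundary is needed. *)

Require Import Defs.
From HB Require Import structures.
From mathcomp Require Import all_boot all_order all_algebra.
From mathcomp Require Import all_classical all_reals all_analysis.
From mathcomp Require Import ring.

Set Implicit Arguments.
Unset Strict Implicit.
Unset Printing Implicit Defensive.

Import Order.TTheory GRing.Theory Num.Theory.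
Import numFieldNormedType.Exports.
Local Open Scope classical_set_scope.
Local Open Scope ring_scope.

(** * Rotations by quaternions, in coordinates *)

Section Quaternion_rotation.
Context {R : realType}.
Implicit Types (q : quaternion R) (u v w : 'rV[R]_3).

Lemma dotE u v : dot u v = u 0 0 * v 0 0 + u 0 1 * v 0 1 + u 0 2 * v 0 2.
Proof.
rewrite /dot mxE !big_ord_recl big_ord0 !mxE addr0 addrA.
by do !congr (_ + _); congr (u _ _ * v _ _); apply/val_inj.
Qed.

(** Case analysis phrased with the numerals 0, 1, 2, so that the coordinates it produces match those
    of [dotE] and [cross] as atoms for [ring]. *)
Lemma ord3P (Q : 'I_3 -> Prop) : Q 0 -> Q 1 -> Q 2 -> forall i, Q i.
Proof.
by move=> Q0 Q1 Q2 [[|[|[|//]]] i3]; [move: Q0|move: Q1|move: Q2];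
  congr Q; apply/val_inj.
Qed.

(* The matrix of v |-> q v q^* acting on row vectors. *)
Definition qrot q : 'M[R]_3 :=
  let a := q.1 in let x := q.2 0 0 in let y := q.2 0 1 in let z := q.2 0 2 in
  \matrix_(i, j) (nth [::] [:: [:: a ^+ 2 + x ^+ 2 - y ^+ 2 - z ^+ 2;
                         2 * (x * y + a * z); 2 * (x * z - a * y)];
                     [:: 2 * (x * y - a * z);
                         a ^+ 2 - x ^+ 2 + y ^+ 2 - z ^+ 2; 2 * (y * z + a * x)];
                     [:: 2 * (x * z + a * y); 2 * (y * z - a * x);
                         a ^+ 2 - x ^+ 2 - y ^+ 2 + z ^+ 2]] i)`_j.

Lemma mul_qrotE u q j : (u *m qrot q) 0 j =
  u 0 0 * qrot q 0 j + u 0 1 * qrot q 1 j + u 0 2 * qrot q 2 j.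
Proof.
rewrite mxE !big_ord_recl big_ord0 addr0 addrA.
by do !congr (_ + _); congr (u _ _ * qrot q _ _); apply/val_inj.
Qed.

(** With N the squared norm of q, two polynomial identities hold for every quaternion: the product
    of [qrot q] and its transpose is N^2 times the identity, and the determinant is N^3. Here N =
    1. *)
Lemma qrot_orthogonal q : unit_quaternion q -> SO3 (qrot q).
Proof.
rewrite /unit_quaternion /qnorm2 dotE => q1; split.
  apply/matrixP => i j.
  have -> : (qrot q *m (qrot q)^T) i j =
    (q.1 ^+ 2 + (q.2 0 0 * q.2 0 0 + q.2 0 1 * q.2 0 1 + q.2 0 2 * q.2 0 2)) ^+ 2
      *+ (i == j).
    move: i j; apply: ord3P; apply: ord3P;
    by rewrite mxE !big_ord_recl big_ord0 !mxE /=; ring.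
  by rewrite q1 expr1n !mxE.
transitivity
  ((q.1 ^+ 2 + (q.2 0 0 * q.2 0 0 + q.2 0 1 * q.2 0 1 + q.2 0 2 * q.2 0 2)) ^+ 3).
  rewrite (expand_det_row _ 0) !big_ord_recl big_ord0 /cofactor.
  rewrite !(expand_det_row _ 0) !big_ord_recl !big_ord0 /cofactor.
  rewrite !det_mx11 !mxE /=; ring.
by rewrite q1 expr1n.
Qed.

Lemma hopfE q : unit_quaternion q -> (hopf q).2 = e3 *m qrot q.
Proof.
rewrite /unit_quaternion => q1; apply/rowP; apply: ord3P.
all: rewrite mul_qrotE /hopf /qinv q1 /qmul /qim /= !dotE !mxE /= ?mxE /=.
all: by rewrite divr1 invr1; ring.
Qed.

Lemma qmul_qim_linear q :
  linear (fun w => (qmul q (qim w)).1 : R^o) /\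
  forall i, linear (fun w => (qmul q (qim w)).2 0 i : R^o).
Proof.
split=> [|i] a u v; rewrite /qmul /qim /=.
  by rewrite !dotE !mxE /GRing.scale /=; ring.
by move: i; apply: ord3P; rewrite !mxE /= ?mxE /GRing.scale /=; ring.
Qed.

Lemma cross_linear u i : linear (fun w => (2 *: cross u w) 0 i : R^o).
Proof.
by move=> a v w; move: i; apply: ord3P; rewrite !mxE /= ?mxE /GRing.scale /=; ring.
Qed.

(** The hypotheses are q' = q w and p' = 2 p x w at t. Each coordinate of q p q^* is a cubic
    polynomial in those of q and p, so the product rule reduces the claim to a polynomial identity.
    It serves both for a pole solution p and for the constant p = e3. *)
Lemma is_derive_mul_qrot (q : R -> quaternion R) (p : R -> 'rV[R]_3) w (t : R) :
  is_derive t (1 : R) (fun s => (q s).1) (qmul (q t) (qim w)).1 ->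
  (forall i, is_derive t (1 : R) (fun s => (q s).2 0 i)
               ((qmul (q t) (qim w)).2 0 i)) ->
  (forall i, is_derive t (1 : R) (fun s => p s 0 i) ((2 *: cross (p t) w) 0 i)) ->
  forall j, is_derive t (1 : R) (fun s => (p s *m qrot (q s)) 0 j) 0.
Proof.
move=> da dq dp.
have dx := dq 0; have dy := dq 1; have dz := dq 2.
have dp0 := dp 0; have dp1 := dp 1; have dp2 := dp 2.
set a : R -> R := fun s => (q s).1 in da.
set x : R -> R := (fun s => (q s).2 0 0) in dx.
set y : R -> R := (fun s => (q s).2 0 1) in dy.
set z : R -> R := (fun s => (q s).2 0 2) in dz.
set p0 : R -> R := (fun s => p s 0 0) in dp0.
set p1 : R -> R := (fun s => p s 0 1) in dp1.
set p2 : R -> R := (fun s => p s 0 2) in dp2.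
have scE (c d : R) : c *: (d : R) = c * d by [].
(* Splits the goal in three: a derivative g' of g assembled by the product rule, the agreement of g
   with the coordinate, and g' = 0. The last two are left to [ring]. *)
have E (g : R -> R) (g' : R) j : is_derive t (1 : R) g g' ->
    (forall s, (p s *m qrot (q s)) 0 j = g s) -> g' = 0 ->
    is_derive t (1 : R) (fun s => (p s *m qrot (q s)) 0 j) 0.
  by move=> dg eg <-; rewrite (_ : (fun s => _) = g) //; apply/funext.
apply: ord3P.
(* The nested term follows column 0 of [qrot], entry by entry; the next two cases do the same for
   columns 1 and 2. *)
- apply: (E _ _ _ (is_deriveD (is_deriveD
    (is_deriveM dp0 (is_deriveB (is_deriveB (is_deriveD (is_deriveM da da) (is_deriveM dx dx))
      (is_deriveM dy dy)) (is_deriveM dz dz)))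
    (is_deriveM dp1 (is_deriveZ 2 (is_deriveB (is_deriveM dx dy) (is_deriveM da dz)))))
    (is_deriveM dp2 (is_deriveZ 2 (is_deriveD (is_deriveM dx dz) (is_deriveM da dy)))))) => [s|].
    by rewrite mul_qrotE !mxE /= !fctE /= !scE /p0 /p1 /p2 /a /x /y /z; ring.
  by rewrite /qmul /qim /= !mxE /= !dotE !fctE /= !scE /p0 /p1 /p2 /a /x /y /z; ring.
- apply: (E _ _ _ (is_deriveD (is_deriveD
    (is_deriveM dp0 (is_deriveZ 2 (is_deriveD (is_deriveM dx dy) (is_deriveM da dz))))
    (is_deriveM dp1 (is_deriveB (is_deriveD (is_deriveB (is_deriveM da da) (is_deriveM dx dx))
      (is_deriveM dy dy)) (is_deriveM dz dz))))
    (is_deriveM dp2 (is_deriveZ 2 (is_deriveB (is_deriveM dy dz) (is_deriveM da dx)))))) => [s|].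
    by rewrite mul_qrotE !mxE /= !fctE /= !scE /p0 /p1 /p2 /a /x /y /z; ring.
  by rewrite /qmul /qim /= !mxE /= !dotE !fctE /= !scE /p0 /p1 /p2 /a /x /y /z; ring.
- apply: (E _ _ _ (is_deriveD (is_deriveD
    (is_deriveM dp0 (is_deriveZ 2 (is_deriveB (is_deriveM dx dz) (is_deriveM da dy))))
    (is_deriveM dp1 (is_deriveZ 2 (is_deriveD (is_deriveM dy dz) (is_deriveM da dx)))))
    (is_deriveM dp2 (is_deriveD (is_deriveB (is_deriveB (is_deriveM da da) (is_deriveM dx dx))
      (is_deriveM dy dy)) (is_deriveM dz dz))))) => [s|].
    by rewrite mul_qrotE !mxE /= !fctE /= !scE /p0 /p1 /p2 /a /x /y /z; ring.
  by rewrite /qmul /qim /= !mxE /= !dotE !fctE /= !scE /p0 /p1 /p2 /a /x /y /z; ring.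
Qed.

(** Continuity of a polynomial, for an arbitrary filter so that it covers limits taken within the
    closed half surface. *)
Lemma cvg_mul_qrot (T : Type) (F : set_system T) {FF : Filter F} (q : T -> quaternion R)
    (p : T -> 'rV[R]_3) (q0 : quaternion R) (p0 : 'rV[R]_3) :
  (q s).1 @[s --> F] --> q0.1 ->
  (forall i, (q s).2 0 i @[s --> F] --> q0.2 0 i) ->
  (forall i, p s 0 i @[s --> F] --> p0 0 i) ->
  forall j, (p s *m qrot (q s)) 0 j @[s --> F] --> (p0 *m qrot q0) 0 j.
Proof.
move=> ca cq cp; have cx := cq 0; have cy := cq 1; have cz := cq 2.
have cp0 := cp 0; have cp1 := cp 1; have cp2 := cp 2.
have E j : (fun s => (p s *m qrot (q s)) 0 j) = fun s =>
  p s 0 0 * qrot (q s) 0 j + p s 0 1 * qrot (q s) 1 j + p s 0 2 * qrot (q s) 2 j.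
  by apply/funext => s; rewrite mul_qrotE.
have c2 : 2 @[s --> F] --> (2 : R) by exact: cvg_cst.
have D (g : T -> R) (l : R) i j : g s @[s --> F] --> l ->
    (forall s, qrot (q s) i j = g s) -> qrot q0 i j = l ->
    qrot (q s) i j @[s --> F] --> qrot q0 i j.
  by move=> + /funext -> ->.
have C i j : qrot (q s) i j @[s --> F] --> qrot q0 i j.
  move: i j; apply: ord3P; apply: ord3P.
  - by apply: (D _ _ _ _ (cvgB (cvgB (cvgD (cvgM ca ca) (cvgM cx cx))
      (cvgM cy cy)) (cvgM cz cz))) => [s|];
      rewrite mxE ?fctE /=; ring.
  - by apply: (D _ _ _ _ (cvgM c2 (cvgD (cvgM cx cy) (cvgM ca cz)))) => [s|];
      rewrite mxE ?fctE /=; ring.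
  - by apply: (D _ _ _ _ (cvgM c2 (cvgB (cvgM cx cz) (cvgM ca cy)))) => [s|];
      rewrite mxE ?fctE /=; ring.
  - by apply: (D _ _ _ _ (cvgM c2 (cvgB (cvgM cx cy) (cvgM ca cz)))) => [s|];
      rewrite mxE ?fctE /=; ring.
  - by apply: (D _ _ _ _ (cvgB (cvgD (cvgB (cvgM ca ca) (cvgM cx cx))
      (cvgM cy cy)) (cvgM cz cz))) => [s|];
      rewrite mxE ?fctE /=; ring.
  - by apply: (D _ _ _ _ (cvgM c2 (cvgD (cvgM cy cz) (cvgM ca cx)))) => [s|];
      rewrite mxE ?fctE /=; ring.
  - by apply: (D _ _ _ _ (cvgM c2 (cvgD (cvgM cx cz) (cvgM ca cy)))) => [s|];
      rewrite mxE ?fctE /=; ring.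
  - by apply: (D _ _ _ _ (cvgM c2 (cvgB (cvgM cy cz) (cvgM ca cx)))) => [s|];
      rewrite mxE ?fctE /=; ring.
  - by apply: (D _ _ _ _ (cvgD (cvgB (cvgB (cvgM ca ca) (cvgM cx cx))
      (cvgM cy cy)) (cvgM cz cz))) => [s|];
      rewrite mxE ?fctE /=; ring.
move=> j; rewrite E mul_qrotE.
by apply: cvgD; [apply: cvgD|]; apply: cvgM => //; exact: C.
Qed.

End Quaternion_rotation.

(** * Linear forms and relative differentials along curves *)

Lemma linear_fun_scale (R : realType) (V : lmodType R) (L : V -> R) :
  linear (L : _ -> R^o) -> L 0 = 0 /\ forall a v, L (a *: v) = a * L v.
Proof.
move=> linL; have L0 : L 0 = 0.
  have := linL 1 0 0; rewrite scaler0 addr0 scale1r => L00.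
  by apply: (addrI (L 0)); rewrite addr0 -L00.
by split=> // a v; rewrite -[a *: v]addr0 linL L0 addr0.
Qed.

Section Calculus_within.
Context {R : realType}.

Lemma linear_rV_continuous n (L : 'rV[R]_n -> R) :
  linear (L : _ -> R^o) -> continuous L.
Proof.
move=> linL.
(* Bundles the bare function with its linearity proof, to expand it over the canonical basis as a
   finite sum of continuous terms. *)
pose M := GRing.isLinear.Build R 'rV[R]_n R^o *:%R L linL.
pose L' : {linear 'rV[R]_n -> R^o} := HB.pack L M.
have -> : L = fun v => \sum_i v 0 i * L (delta_mx 0 i).
  apply/funext => v; rewrite {1}(row_sum_delta v) [LHS](linear_sum L').
  by apply: eq_bigr => i _; rewrite [LHS](linearZ_LR L').
apply: (@continuous_big _ _ +%R) => [|i _ v]; first exact: add_continuous.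
have ci : {for v, continuous (fun x : 'rV[R]_n => x 0 i)}.
  exact: coord_continuous.
by apply: (continuousM ci); exact: cst_continuous.
Qed.

Lemma coord_le_norm n (v : 'rV[R]_n) i : `|v 0 i| <= `|v|.
Proof.
rewrite [leRHS]/Num.norm /= mx_normrE.
exact: (le_bigmax _ (fun ij => `|v ij.1 ij.2|) (0, i)).
Qed.

Lemma coord_prod_le (q : quaternion R) i : `|q.2 0 i| <= `|q|.
Proof.
apply: le_trans (coord_le_norm _ _) _.
by rewrite prod_normE le_max lexx orbT.
Qed.

Lemma fst_prod_le (q : quaternion R) : `|q.1| <= `|q|.
Proof. by rewrite prod_normE le_max lexx. Qed.

(** An additive map that does not increase norms preserves the remainder estimate. It is applied to
    coordinate projections, which turns vector equations into scalar ones. *)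
Lemma diff_within_comp (V W W' : normedModType R) (A : set V) (h : V -> W) x L
    (pi : W -> W') :
  (forall u v, pi (u - v) = pi u - pi v) -> (forall w, `|pi w| <= `|w|) ->
  diff_within A h x L -> diff_within A (pi \o h) x (pi \o L).
Proof.
move=> piB pi_le hL e /hL; apply: filterS => y /=.
by rewrite -!piB; exact: le_trans.
Qed.

(** Chain rule for a differential relative to A: the curve stays in A near t, so the relative
    estimate applies at all nearby parameters. *)
Lemma is_derive_diff_within (V : normedModType R) (A : set V) (h : V -> R)
    (c : R -> V) (t : R) (L : V -> R) (dc : V) :
  (forall a v, L (a *: v) = a * L v) -> {for dc, continuous L} ->
  (\forall s \near t, A (c s)) -> is_derive t (1 : R) c dc ->
  diff_within A (h : V -> R^o) (c t) L -> is_derive t (1 : R) (h \o c) (L dc).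
Proof.
move=> LZ Lc Ac [dc1 dcE] hL.
have ct : {for t, continuous c}.
  by apply: differentiable_continuous; exact/derivable1_diffP.
pose Q s : V := s^-1 *: (c (s + t) - c t).
have Qdc : Q s @[s --> 0^'] --> dc.
  rewrite -dcE; move: dc1; rewrite /derivable /derive /Q /shift /=.
  under eq_fun do rewrite [_ *: 1]mulr1.
  by [].
have shift_t : (s + t) @[s --> (0:R)^'] --> t.
  rewrite -[X in _ --> X]add0r; apply: cvg_within_filter.
  by apply: cvgD; [exact: cvg_id|exact: cvg_cst].
suff dif : s^-1 * (h (c (s + t)) - h (c t)) @[s --> (0:R)^'] --> L dc.
  have dif' : (fun s : R => s^-1 *: ((h \o c \o shift t) (s *: (1 : R)) - (h \o c) t))
      @ 0^' --> L dc.
    move: dif; rewrite /shift /=.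
    by under [X in _ -> X @ _ --> _]eq_fun do rewrite [_ *: 1]mulr1.
  split; first by apply/cvg_ex; exists (L dc).
  exact: cvg_lim.
have LQ : L (Q s) @[s --> (0:R)^'] --> L dc by apply: cvg_comp Qdc _.
rewrite -[X in _ --> X]add0r.
(* The difference quotient of h along c is L (Q s), which tends to L dc, plus a remainder to be
   shown to tend to 0. *)
under eq_cvg => s do rewrite -(subrK (L (Q s)) (s^-1 * _)).
apply: cvgD LQ; apply/cvgrPdist_le => e e0.
(* Eventually |Q s| <= |dc| + 1, so this choice bounds the remainder by e' (|dc| + 1) = e. *)
pose e' := e / (`|dc| + 1).
have e'0 : 0 < e' by rewrite divr_gt0 // ltr_wpDl.
have hL' : \forall y \near c t, A y ->
    `|h y - h (c t) - L (y - c t)| <= e' * `|y - c t|.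
  exact: hL _ e'0.
have h1 : \forall s \near (0:R)^', A (c (s + t)) ->
   `|h (c (s+t)) - h (c t) - L (c (s+t) - c t)| <= e' * `|c (s+t) - c t|.
  have cc : c (s + t) @[s --> (0:R)^'] --> c t by apply: cvg_comp shift_t ct.
  exact: (cc _ hL').
have h2 : \forall s \near (0:R)^', A (c (s + t)) by exact: (shift_t _ Ac).
have h3 : \forall s \near (0:R)^', `|Q s| <= `|dc| + 1.
  have /cvgrPdist_le /(_ 1 ltr01) := Qdc; apply: filterS => s ds.
  rewrite -lerBlDl; apply: le_trans ds.
  by rewrite distrC; exact: lerB_dist.
have h4 : \forall s \near (0:R)^', s != 0 by exact: nbhs_dnbhs_neq.
near=> s.
have s0 : s != 0 by near: s.
have As : A (c (s + t)) by near: s.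
have Qs : `|Q s| <= `|dc| + 1 by near: s.
have hs : `|h (c (s+t)) - h (c t) - L (c (s+t) - c t)| <= e' * `|c (s+t) - c t|.
  by apply: (near h1 s).
rewrite sub0r normrN /Q LZ -mulrBr normrM.
apply: (@le_trans _ _ (`|s^-1| * (e' * `|c (s+t) - c t|))).
  by rewrite ler_pM.
rewrite mulrCA -normrZ -/(Q s).
apply: le_trans (ler_pM _ _ (lexx e') Qs) _ => //; first exact: ltW.
by rewrite /e' divfK // gt_eqF // ltr_wpDl.
Unshelve. all: by end_near.
Qed.

(** Mean value theorem. *)
Lemma is_derive0_segment (g : R -> R) (a b : R) : a <= b ->
  (forall t, t \in `[a, b] -> is_derive t (1 : R) g 0) -> g a = g b.
Proof.
move=> ab dg.
have dgo (t : R) : t \in `]a, b[%R -> is_derive t (1 : R) g ((fun=> 0) t).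
  by move=> tab; apply: dg; exact: subset_itv_oo_cc.
have cg : {within `[a, b], continuous g}.
  apply: derivable_within_continuous => t tab.
  by have [] := dg t tab.
have [c _] := MVT_segment ab dgo cg.
by rewrite mul0r => /subr0_eq.
Qed.

End Calculus_within.

(** * Connectedness and locally constant functions *)

Section Connectedness.
Lemma locally_constant_connected (T : topologicalType) (Y : Type) (A : set T)
    (u : T -> Y) : connected A -> open A ->
  (forall x, A x -> \forall y \near x, u y = u x) ->
  forall x y, A x -> A y -> u x = u y.
Proof.
move=> cA oA lc x y Ax Ay.
(* B is open, and closed relatively to A because C is open too; being nonempty, it is all of A. *)
pose B := [set z | A z /\ u z = u x]; pose C := [set z | A z /\ u z <> u x].
have oB : open B.
  rewrite openE => z [Az zx]; rewrite /interior.
  near=> w; split; last by rewrite -zx; near: w; exact: lc.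
  by near: w; exact: open_nbhs_nbhs.
have oC : open C.
  rewrite openE => z [Az zx]; rewrite /interior.
  near=> w; split; first by near: w; exact: open_nbhs_nbhs.
  by have -> : u w = u z by near: w; exact: lc.
suff : B = A by move=> BA; have [] : B y by rewrite BA.
apply: cA.
- by exists x.
- by exists B => //; apply/seteqP; split=> [z []|z []].
- exists (~` C); first exact: open_closedC.
  apply/seteqP; split=> [z [Az zx]|z [Az nC]]; first by split=> // -[].
  by split=> //; apply: contrapT => zx; apply: nC.
Unshelve. all: by end_near.
Qed.

(** The set is a union of segments that all contain the origin. *)
Lemma connected_star (R : realType) (V : normedModType R) (A : set V) :
  (forall x (t : R), A x -> t \in `[0, 1] -> A (t *: x)) -> connected A.
Proof.
move=> sA.
have -> : A = \bigcup_(x in A) ((fun t : R => t *: x) @` `[0, 1]).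
  apply/seteqP; split=> [x Ax|x [y Ay [t t01 <-]]]; last exact: sA.
  by exists x => //; exists 1; rewrite ?scale1r //= in_itv /= ler01 lexx.
apply: bigcup_connected.
  by exists 0 => x Ax; exists 0; rewrite ?scale0r //= in_itv /= ler01 lexx.
move=> x Ax; apply: connected_continuous_connected; first exact: segment_connected.
by apply: continuous_subspaceT => t; exact: scalel_continuous.
Qed.

Lemma connected_disc (R : realType) : connected [set x : 'rV[R]_2 | enorm x < 1].
Proof.
apply: connected_star => x t /= x1; rewrite in_itv /= => /andP[t0 t1].
apply: le_lt_trans x1; rewrite /enorm ler_wsqrtr //.
rewrite /dot linearZ /= -scalemxAl -scalemxAr !mxE mulrA.
rewrite -[leRHS]mul1r ler_wpM2r //; last by rewrite mulr_ile1.
by apply: sumr_ge0 => i _; rewrite !mxE -expr2 sqr_ge0.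
Qed.

End Connectedness.

(** * Curves and functions on manifolds, read in charts *)

Lemma is_derive_line (R : realType) (V : normedModType R) (x v : V) (t : R) :
  is_derive t (1 : R) (fun s : R => x + s *: v) v.
Proof.
have d : (fun h : R => h^-1 *: (((fun s : R => x + s *: v) \o shift t) (h *: (1 : R))
    - (x + t *: v))) @ 0^' --> v.
  apply: cvg_near_cst; near=> h.
  have h0 : h != 0 by near: h; exact: nbhs_dnbhs_neq.
  rewrite /= /shift /= [_ *: 1]mulr1 opprD addrACA subrr add0r -scalerBl addrK.
  by rewrite scalerA mulVf // scale1r.
by split; [apply/cvg_ex; exists v|exact: cvg_lim].
Unshelve. all: by end_near.
Qed.

Section Charts.
Context {R : realType} {n : nat} {H : set 'rV[R]_n} (M : manifold H).
Implicit Types (c : @chart R M n) (q : M).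

Lemma chart_open c : atlas c -> open (cdom c).
Proof. by have [+ _ _] := manifold_atlas M => /[apply] -[]. Qed.

Lemma cmapK c q : atlas c -> cdom c q -> cinv c (cmap c q) = q.
Proof.
move=> ac cq; have [/(_ _ ac)[_ [U _ [K _ _ _]]] _ _] := manifold_atlas M.
by have [] := K q cq.
Qed.

Lemma cmap_continuous c q : atlas c -> cdom c q -> {for q, continuous (cmap c)}.
Proof.
move=> ac cq; have oc := chart_open ac.
have [/(_ _ ac)[_ [U _ [_ _ + _]]] _ _] := manifold_atlas M.
by rewrite continuous_open_subspace // => /(_ q); apply; rewrite inE.
Qed.

(** Near t, u along g is the chart expression of u composed with the chart expression of g, so the
    relative chain rule applies; [pi] selects a scalar coordinate. *)
Lemma is_derive_along_curve (W : normedModType R) (A : set M) (u : M -> W)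
    (omega : @chart R M n -> 'rV[R]_n -> 'rV[R]_n -> W) (pi : W -> R)
    (g : R -> M) (t : R) c (dx : 'rV[R]_n) :
  (forall u v, pi (u - v) = pi u - pi v) -> (forall w, `|pi w| <= `|w|) ->
  linear (pi \o omega c (cmap c (g t)) : _ -> R^o) ->
  differential_eq A u omega -> atlas c ->
  (\forall s \near t, A (g s) /\ cdom c (g s)) ->
  is_derive t (1 : R) (cmap c \o g) dx ->
  is_derive t (1 : R) (fun s => pi (u (g s))) (pi (omega c (cmap c (g t)) dx)).
Proof.
move=> piB pi_le linL du ac nAc dg.
have [Agt cgt] : A (g t) /\ cdom c (g t) by exact: nbhs_singleton nAc.
have := diff_within_comp piB pi_le (du _ _ ac cgt Agt).
move=> /(@is_derive_diff_within _ _ _ _ (cmap c \o g) t _ dx) h.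
apply: near_eq_is_derive; last apply: h => //.
- by near=> s; rewrite /= /in_chart /= cmapK //; apply: (near nAc s _).2.
- exact: (linear_fun_scale linL).2.
- exact: linear_rV_continuous.
- near=> s; exists (g s) => //; split; last by apply: (near nAc s _).1.
  by apply: (near nAc s _).2.
Unshelve. all: by end_near.
Qed.

(** Differentiability relative to A gives continuity relative to A, also at points of A that are not
    interior. *)
Lemma differential_eq_cvg (W : normedModType R) (A : set M) (u : M -> W)
    (omega : @chart R M n -> 'rV[R]_n -> 'rV[R]_n -> W) (pi : W -> R) q :
  (forall u v, pi (u - v) = pi u - pi v) -> (forall w, `|pi w| <= `|w|) ->
  (forall c x, linear (pi \o omega c x : _ -> R^o)) ->
  differential_eq A u omega -> A q ->
  pi (u y) @[y --> within A (nbhs q)] --> pi (u q).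
Proof.
move=> piB pi_le linL du Aq.
have [_ /(_ q)[c ac cq] _] := manifold_atlas M.
have := diff_within_comp piB pi_le (du _ _ ac cq Aq).
set L : 'rV[R]_n -> R := pi \o omega c _; set x := cmap c q => hL.
have cL : continuous L by exact: (linear_rV_continuous (linL c _)).
have L0 : L 0 = 0 by exact: (linear_fun_scale (linL c (cmap c q))).1.
apply/cvgrPdist_le => e e0.
have e20 : 0 < e / 2 by rewrite divr_gt0.
have cx := cmap_continuous ac cq.
have dx : cmap c y - x @[y --> q] --> (0 : 'rV[R]_n).
  by rewrite -(subrr x); apply: cvgB cx _; exact: cvg_cst.
(* The differential estimate is used with constant 1. The remainder and the linear term then each
   contribute at most e / 2. *)
have n1 : \forall y \near q, A y -> cdom c y ->
    `|pi (u y) - pi (u q) - L (cmap c y - x)| <= `|cmap c y - x|.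
  have : \forall y \near q, (cmap c @` (cdom c `&` A)) (cmap c y) ->
      `|pi (in_chart u c (cmap c y)) - pi (in_chart u c x) - L (cmap c y - x)|
        <= 1 * `|cmap c y - x|.
    exact: (cx _ (hL _ ltr01)).
  apply: filterS => y + Ay cy.
  by rewrite /in_chart /= !cmapK // mul1r; apply; exists y.
have n2 : \forall y \near q, `|cmap c y - x| <= e / 2.
  have /cvgrPdist_le /(_ _ e20) := dx.
  by apply: filterS => y; rewrite sub0r normrN.
have n3 : \forall y \near q, `|L (cmap c y - x)| <= e / 2.
  have Ld : L (cmap c y - x) @[y --> q] --> L 0 by apply: cvg_comp dx (cL 0).
  have /cvgrPdist_le /(_ _ e20) := Ld.
  by apply: filterS => y; rewrite L0 sub0r normrN.
have n4 : \forall y \near q, cdom c y.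
  by apply: open_nbhs_nbhs; split => //; exact: chart_open.
rewrite near_withinE; near=> y => Ay.
have h1 := near n1 y _ Ay; have h2 := near n2 y; have h3 := near n3 y.
have cy : cdom c y by near: y.
rewrite distrC -(subrK (L (cmap c y - x)) (_ - _)).
rewrite (splitr e); apply: le_trans (ler_normD _ _) _; apply: lerD.
  by apply: (@le_trans _ _ `|cmap c y - x|); [apply: h1|apply: h2].
by apply: h3.
Unshelve. all: by end_near.
Qed.

End Charts.

(** Smoothness provides a local smooth extension; since g is continuous and chart domains are open,
    it agrees with [cmap c \o g] on a full neighbourhood of t. *)
Lemma smooth_curve_derivable (R : realType) n (H : set 'rV[R]_n) (M : manifold H)
    (g : R -> M) (c : @chart R M n) (t : R) :
  smooth_curve g -> atlas c -> cdom c (g t) ->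
  is_derive t (1 : R) (cmap c \o g) (derive1 (cmap c \o g) t).
Proof.
move=> [cg sg] ac cgt; rewrite derive1E.
suff : derivable (cmap c \o g) t 1 by move=> /derivableP.
have [U [u [oU Ut Cu uE]]] := sg _ ac t cgt.
have du : derivable (u : R -> 'rV[R]_n) t 1.
  by have [/(_ t Ut) du _] := Cu 1%N; apply/derivable1_diffP.
apply: near_eq_derivable du; near=> s; apply/esym; apply: uE.
  near: s; apply: cg; apply: open_nbhs_nbhs; split => //; exact: chart_open.
by near: s; exact: open_nbhs_nbhs.
Unshelve. all: by end_near.
Qed.

(** * Conjugating a pole solution by the cousin *)

Section Pole_solutions.
Context {R : realType} {S : surface R}.
Context (f : S -> 'rV[R]_3) (J : @chart R S 2 -> 'rV[R]_2 -> 'M[R]_2).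
Context (A : set S) (ft : S -> quaternion R) (P : S -> 'rV[R]_3).

Let dft c x v := qmul (in_chart ft c x) (qim (dfJ f J c x v)).
Let dP c x v := 2 *: cross (in_chart P c x) (dfJ f J c x v).

Context (hft : differential_eq A ft dft) (hP : differential_eq A P dP).

Lemma linear_comp_dfJ (L : 'rV[R]_3 -> R^o) c x :
  linear L -> linear (fun v => L (dfJ f J c x v)).
Proof. by move=> linL a u v; rewrite /dfJ !mulmxDl -!scalemxAl linL. Qed.

(** Puts the cousin equation along a curve in the form q' = q w required by [is_derive_mul_qrot],
    with w the value of df o J on the velocity. *)
Lemma is_derive_cousin (g : R -> S) (t : R) c (dx : 'rV[R]_2) :
  atlas c -> (\forall s \near t, A (g s) /\ cdom c (g s)) ->
  is_derive t (1 : R) (cmap c \o g) dx ->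
  let w := dfJ f J c (cmap c (g t)) dx in
  is_derive t (1 : R) (fun s => (ft (g s)).1) (qmul (ft (g t)) (qim w)).1 /\
  forall i, is_derive t (1 : R) (fun s => (ft (g s)).2 0 i)
               ((qmul (ft (g t)) (qim w)).2 0 i).
Proof.
move=> ac nA dg w.
have [_ cgt] : A (g t) /\ cdom c (g t) by exact: nbhs_singleton nA.
have E : qmul (ft (g t)) (qim w) = dft c (cmap c (g t)) dx.
  by rewrite /dft /in_chart /= cmapK.
rewrite E; split=> [|i].
- apply: (is_derive_along_curve (pi := fst)) hft ac nA dg => //.
    exact: fst_prod_le.
  exact: linear_comp_dfJ (qmul_qim_linear _).1.
- apply: (is_derive_along_curve (pi := fun q : quaternion R => q.2 0 i))
    hft ac nA dg => //.
  + by move=> u v; rewrite !mxE.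
  + by move=> q; exact: coord_prod_le.
  + exact: linear_comp_dfJ ((qmul_qim_linear _).2 i).
Qed.

Lemma is_derive_pole (g : R -> S) (t : R) c (dx : 'rV[R]_2) :
  atlas c -> (\forall s \near t, A (g s) /\ cdom c (g s)) ->
  is_derive t (1 : R) (cmap c \o g) dx ->
  forall i, is_derive t (1 : R) (fun s => P (g s) 0 i)
    ((2 *: cross (P (g t)) (dfJ f J c (cmap c (g t)) dx)) 0 i).
Proof.
move=> ac nA dg i.
have [_ cgt] : A (g t) /\ cdom c (g t) by exact: nbhs_singleton nA.
have -> : 2 *: cross (P (g t)) (dfJ f J c (cmap c (g t)) dx)
    = dP c (cmap c (g t)) dx by rewrite /dP /in_chart /= cmapK.
apply: (is_derive_along_curve (pi := fun v : 'rV[R]_3 => v 0 i))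
  hP ac nA dg => //.
- by move=> u v; rewrite !mxE.
- by move=> v; exact: coord_le_norm.
- exact: linear_comp_dfJ (cross_linear _ i).
Qed.

Lemma conjugated_pole_locally_constant q : A° q ->
  \forall q' \near q, P q' *m qrot (ft q') = P q *m qrot (ft q).
Proof.
move=> Aq.
have [_ /(_ q)[c ac cq] _] := manifold_atlas S.
have [/(_ _ ac)[oc [U oU [fK gK _ ginv]]] _ _] := manifold_atlas S.
have cx := cmap_continuous ac cq.
have Ux : U (cmap c q) by have [[]] := fK q cq.
have icont : {for cmap c q, continuous (cinv c)}.
  (* A surface is modelled on the whole plane, so the chart image U is open and continuity within U
     is ordinary continuity. *)
  move: ginv; rewrite setIT continuous_open_subspace // => /(_ (cmap c q)); apply.
  by rewrite inE.
have n1 : \forall y \near cmap c q, U y /\ A° (cinv c y).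
  near=> y; split; first by near: y; exact: open_nbhs_nbhs.
  near: y; apply: icont; rewrite cmapK //.
  by apply: open_nbhs_nbhs; split => //; exact: open_interior.
(* A ball in the chart image lying over the interior of A: being convex, it contains the coordinate
   segment from q to any nearby q'. *)
have /nbhs_ballP[e /= e0 be] := n1.
have n2 : \forall q' \near q, ball (cmap c q) e (cmap c q').
  by apply: cx; exact: nbhsx_ballx.
have n3 : \forall q' \near q, cdom c q' by exact: open_nbhs_nbhs.
near=> q'.
have cq' : cdom c q' by near: q'.
have bq' : ball (cmap c q) e (cmap c q') by near: q'.
pose x := cmap c q; pose v := cmap c q' - x.
pose g t := cinv c (x + t *: v).
have seg (t : R) : t \in `[0, 1] -> ball x e (x + t *: v).
  rewrite in_itv /= => /andP[t0 t1]; move: bq'.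
  rewrite -!ball_normE /ball_ /= opprD addrA subrr add0r normrN normrZ.
  rewrite distrC -/v ger0_norm // => ve.
  by apply: le_lt_trans ve; rewrite ler_piMl.
suff gc i : (P (g 0) *m qrot (ft (g 0))) 0 i = (P (g 1) *m qrot (ft (g 1))) 0 i.
  have g0 : g 0 = q by rewrite /g scale0r addr0 cmapK.
  have g1 : g 1 = q' by rewrite /g scale1r addrC subrK cmapK.
  by apply/rowP => i; have := gc i; rewrite g0 g1.
(* Each coordinate has zero derivative along the lifted segment, so its values at q and q'
   coincide. *)
apply: (is_derive0_segment (g := fun t => (P (g t) *m qrot (ft (g t))) 0 i)) => // t t01.
have lc : {for t, continuous (fun s : R => x + s *: v)}.
  apply: continuousD; first exact: cst_continuous.
  exact: scalel_continuous.
have nU : \forall s \near t, U (x + s *: v) /\ A° (cinv c (x + s *: v)).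
  apply: (lc [set y | U y /\ A° (cinv c y)]).
  by apply: (filterS be); apply: open_nbhs_nbhs; split; [exact: ball_open|exact: seg].
have nA : \forall s \near t, A (g s) /\ cdom c (g s).
  apply: filterS nU => s [Us As]; split; first exact: interior_subset As.
  by have [] := gK (x + s *: v).
have dg : is_derive t (1 : R) (cmap c \o g) v.
  apply: (@near_eq_is_derive _ _ _ (fun s : R => x + s *: v)).
    apply: filterS nU => s [Us As] /=.
    by have [] := gK (x + s *: v).
  exact: is_derive_line.
have [da dq] := is_derive_cousin ac nA dg.
exact: is_derive_mul_qrot da dq (is_derive_pole ac nA dg) i.
Unshelve. all: by end_near.
Qed.

Lemma conjugated_pole_cvg q i : A q ->
  (P y *m qrot (ft y)) 0 i @[y --> within A (nbhs q)] --> (P q *m qrot (ft q)) 0 i.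
Proof.
move=> Aq; apply: cvg_mul_qrot.
- apply: (differential_eq_cvg (pi := fst)) hft Aq => //.
    exact: fst_prod_le.
  move=> c x; exact: linear_comp_dfJ (qmul_qim_linear _).1.
- move=> j; apply: (differential_eq_cvg (pi := fun q : quaternion R => q.2 0 j))
    hft Aq => //.
  + by move=> u v; rewrite !mxE.
  + by move=> p; exact: coord_prod_le.
  + move=> c x; exact: linear_comp_dfJ ((qmul_qim_linear _).2 j).
- move=> j; apply: (differential_eq_cvg (pi := fun v : 'rV[R]_3 => v 0 j))
    hP Aq => //.
  + by move=> u v; rewrite !mxE.
  + by move=> v; exact: coord_le_norm.
  + move=> c x; exact: linear_comp_dfJ (cross_linear _ j).
Qed.

End Pole_solutions.

(** * Constancy on the closed half and comparison with the vertices *)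

Theorem proposition15 (R : realType) (k : nat) (S : surface R)
    (f nu : S -> 'rV[R]_3) (h : S -> 'rV[R]_3) (p : 'I_k -> 'rV[R]_3)
    (J : chart S 2 -> 'rV[R]_2 -> 'M[R]_2) (gamma : 'I_k -> R -> S)
    (P : 'I_k -> S -> 'rV[R]_3) (ft : S -> quaternion R)
    (alpha : 'I_k -> 'rV[R]_3)
    (hf : coplanar_unduloid f nu h p)
    (hsym : alexandrov_symmetric f)
    (hJ : complex_structure f nu J)
    (hdisc : upper_half_disc f)
    (hgamma : boundary_curves f J h p gamma)
    (hP : forall j, pole_solution f J (gamma j) (P j))
    (hft : conjugate_cousin f J ft)
    (halpha : forall j, classifying_vertex ft (gamma j) (alpha j)) :
  forall q, closure (upper f) q ->
    exists A : 'M[R]_3, SO3 A /\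
      forall j, (P j q)^T = A *m (alpha j)^T.
Proof.
move=> q Aq; have [ft1 dft] := hft.
have [[_ [[cf _] _] _ _ _] _] := hf.
(* On rows [qrot (ft q)] acts as v |-> q v q^*, with q standing for [ft q]. On columns the same
   matrix acts as the inverse rotation, which takes alpha_j back to P_j. *)
exists (qrot (ft q)); have q1 := qrot_orthogonal (ft1 q Aq); split=> // j.
have [dP [t0 Pt0]] := hP j; have [t1 ht1] := halpha j.
have [bd gj] := hgamma; have {gj} [sg _ _ _ dg] := gj j.
have gA t : closure (upper f) (gamma j t).
  suff : (closure (upper f) `\` upper f) (gamma j t) by case.
  by rewrite bd; exists j => //; exists t.
have oU : open (upper f).
  rewrite (_ : upper f = f @^-1` [set v | 0 < v 0 2]) //.
  apply: open_comp => [x _|]; first exact: cf.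
  apply: (@open_comp _ _ (fun v : 'rV[R]_3 => v 0 2) [set y | 0 < y]).
    by move=> v _; exact: coord_continuous.
  exact: open_gt.
(* The upper half is the continuous image of the disc under the inverse homeomorphism. *)
have cU : connected (upper f).
  have [a [b [aU bU _ cb]]] := hdisc.
  have -> : upper f = b @` [set x : 'rV[R]_2 | enorm x < 1].
    apply/seteqP; split=> [x Ux|x [y y1 <-]]; last by have [] := bU y y1.
    by have [ax1 bax] := aU x Ux; exists (a x).
  exact: connected_continuous_connected (@connected_disc R) cb.
pose u x := P j x *m qrot (ft x).
have uc x y : upper f x -> upper f y -> u x = u y.
  apply: locally_constant_connected => // z Uz.
  apply: (conjugated_pole_locally_constant dft dP).
  apply: filterS (open_nbhs_nbhs (conj oU Uz)); exact: subset_closure.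
have uA x : closure (upper f) x -> forall y, upper f y -> u x = u y.
  move=> Ax y Uy; apply/rowP => i.
  (* If a coordinate differed, relative continuity at x would give z in the open half with u z
     closer to u x, in that coordinate, than u y is; but u z = u y. *)
  apply/eqP/negPn/negP => uxy.
  have e0 : 0 < `|u x 0 i - u y 0 i| by rewrite normr_gt0 subr_eq0.
  have /cvgrPdist_lt /(_ _ e0) := conjugated_pole_cvg dft dP (i := i) Ax.
  rewrite near_withinE => /Ax[z [Uz]] /(_ (subset_closure Uz)).
  by rewrite -/(u x) -/(u z) (uc z y Uz Uy) ltxx.
have uAA x y : closure (upper f) x -> closure (upper f) y -> u x = u y.
  move=> Ax Ay.
  (* The closure has a point x, so the open half contains some z, through which the two values are
     compared. *)
  have [z [Uz _]] := Ax setT filterT.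
  by rewrite (uA x Ax z Uz) (uA y Ay z Uz).
have e3c t t' i : (e3 *m qrot (ft (gamma j t))) 0 i = (e3 *m qrot (ft (gamma j t'))) 0 i.
  apply: (is_derive_0_is_cst (f := fun t => (e3 *m qrot (ft (gamma j t))) 0 i)) => {}t.
  have [_ /(_ (gamma j t))[c ac cg] _] := manifold_atlas S.
  have nA : \forall s \near t, closure (upper f) (gamma j s) /\ cdom c (gamma j s).
    near=> s; split => //; near: s; apply: sg.1.
    by apply: open_nbhs_nbhs; split => //; exact: chart_open.
  have [da dq] := is_derive_cousin dft ac nA (smooth_curve_derivable sg ac cg).
  move: da dq; rewrite dg // => da dq.
  (* Since w = - e3 along the curve, 2 e3 x w = 0, so the constant e3 satisfies the pole equation
     there. *)
  apply: is_derive_mul_qrot da dq _ i => {}i.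
  have -> : (2 *: cross e3 (- e3)) 0 i = 0 :> R.
    by move: i; apply: ord3P; rewrite !mxE /= ?mxE /=; ring.
  exact: is_derive_cst.
(* Move from q to the point at t0, where P_j = e3, then slide along the curve to t1, where the Hopf
   projection is alpha_j. *)
have -> : alpha j = u q.
  rewrite (uAA q (gamma j t0)) // /u Pt0; apply/rowP => i; rewrite (e3c t0 t1).
  by rewrite -hopfE ?ht1 //; exact: ft1.
by rewrite /u trmx_mul mulmxA q1.1 mul1mx.
Unshelve. all: by end_near.
Qed.
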